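(* Let $P$ be a finite supersolvable lattice of rank $n$ with an $M$-chain EL-labeling $\lambda$ (in the sense of Stanley). Let $P_\lambda(2)$ be the maximal chain descent order induced by $\lambda$. Then any interval in $P_\lambda(2)$ is isomorphic to some interval of the weak order on $S_n$ via the map assigning to each maximal chain its label sequence.
   Context: A finite lattice $L$ is supersolvable if it has a maximal chain $M:\hat 0=w_0\lessdot w_1\lessdot\dots\lessdot w_n=\hat 1$ (an $M$-chain) such that for every chain $K$ of $L$ the sublattice generated by $K$ and $M$ is distributive. The $M$-chain EL-labeling is $\lambda(x,y)=\min\{i: x\vee w_i=y\vee w_i\}$ for $x\lessdot y$; the label sequence of each maximal chain is a permutation of $[n]=\{1,\dots,n\}$. For a finite poset $P$ with least element $\hat 0$ and greatest element $\hat 1$, $\mathcal M(P)$ is the set of maximal chains. For a chain $c$ and $x\in c$ write $c^x=\{w\in c: w\le x\}$, $c_x=\{w\in c: w\ge x\}$. An edge labeling $\lambda$ assigns to each cover relation a label in a poset $\Lambda$; a saturated chain gets the sequence of labels of its edges from bottom to top. A sequence is ascending if weakly increasing. $\lambda$ is an EL-labeling if for every $x<y$ the interval $[x,y]$ has a unique ascending maximal chain and it lexicographically precedes all other maximal chains of $[x,y]$. A saturated chain $u\lessdot v\lessdot w$ is a descent if $\lambda(u,v)\not\le\lambda(v,w)$. Polygon move: $m\to m'$ if there are $x<z$ in $m\cap m'$ with $m^x=m'^x$, $m_z=m'_z$, such that $m'\cap[x,z]$ is a descent $x\lessdot y\lessdot z$ with $y\notin m$, while $m\cap[x,z]$ is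 the unique ascending maximal chain of $[x,z]$. The maximal chain descent order $P_\lambda(2)$ is $\mathcal M(P)$ partially ordered by the reflexive and transitive closure of $\to$. Label sequences are regarded as permutations in one-line notation. The weak order on $S_n$ is the (right) weak order: $u\le_{wk}w$ iff $w=us_{i_1}\cdots s_{i_k}$ with $s_i=(i,i+1)$ and $\ell(us_{i_1}\cdots s_{i_j})=\ell(u)+j$ for all $1\le j\le k$, where $\ell$ is the number of inversions; right multiplication by $s_i$ swaps the entries in positions $i,i+1$. *)

(* Defs.v *)
From HB Require Import structures.
From mathcomp Require Import all_boot all_order all_fingroup.

Set Implicit Arguments.
Unset Strict Implicit.
Unset Printing Implicit Defensive.

Import Order.TTheory.
Local Open Scope order_scope.

(* ---- Chains and edge labelings of finite posets ---- *)

Section Poset.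

Context {d : Order.disp_t} {T : finPOrderType d}.

Definition covers (x y : T) : bool :=
  (x < y) && [forall z : T, ~~ ((x < z) && (z < y))].

Definition is_chain (c : {set T}) : bool :=
  [forall x in c, forall y in c, x >=< y].

(* inclusion-maximal among the chains contained in A *)
Definition max_chain_in (A c : {set T}) : bool :=
  maxset (fun b : {set T} => is_chain b && (b \subset A)) c.

Definition citv (x z : T) : {set T} := [set y | x <= y <= z].

Definition chain_below (c : {set T}) (x : T) : {set T} := [set y in c | y <= x].
Definition chain_above (c : {set T}) (x : T) : {set T} := [set y in c | x <= y].

(* An edge labeling is a total function of two arguments; only its values on
   cover relations are ever relevant. *)
Context {d' : Order.disp_t} {Lam : porderType d'}.
Variable lam : T -> T -> Lam.

(* Sorting the elements of a chain lists them from bottom to top. *)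
Definition label_seq (c : {set T}) : seq Lam :=
  let s := sort <=%O (enum c) in
  [seq lam p.1 p.2 | p <- zip s (behead s)].

Definition ascending (c : {set T}) : bool := sorted <=%O (label_seq c).

Definition is_descent (x y z : T) : bool :=
  [&& covers x y, covers y z & ~~ (lam x y <= lam y z)].

(* c is the unique ascending maximal chain of the interval [x, z] *)
Definition unique_ascending (x z : T) (c : {set T}) : bool :=
  [set b : {set T} | max_chain_in (citv x z) b && ascending b] == [set c].

Definition polygon_move_set (m m' : {set T}) : bool :=
  [exists x : T, exists z : T,
    [&& x < z, x \in m :&: m', z \in m :&: m',
        chain_below m x == chain_below m' x,
        chain_above m z == chain_above m' z,
        unique_ascending x z (m :&: citv x z)
      & [exists y : T, [&& is_descent x y z, y \notin m
                         & m' :&: citv x z == [set x; y; z]]]]].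

End Poset.

(* The finite type of maximal chains of T. *)
Definition maxchain {d : Order.disp_t} (T : finPOrderType d) : finType :=
  {c : {set T} | max_chain_in [set: T] c}.

Definition polygon_move {d d' : Order.disp_t} {T : finPOrderType d}
    {Lam : porderType d'} (lam : T -> T -> Lam) : rel (maxchain T) :=
  fun m m' => polygon_move_set lam (val m) (val m').

(* The maximal chain descent order P_lam(2). *)
Definition mcd_le {d d' : Order.disp_t} {T : finPOrderType d}
    {Lam : porderType d'} (lam : T -> T -> Lam) : rel (maxchain T) :=
  connect (polygon_move lam).

(* ---- Supersolvable lattices ---- *)

Section Lattice.

Context {d : Order.disp_t} {L : finTBLatticeType d}.

Definition is_sublattice (S : {set L}) : bool :=
  [forall x in S, forall y in S, (x `&` y \in S) && (x `|` y \in S)].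

Definition gen_sublattice (A : {set L}) : {set L} :=
  \bigcap_(S : {set L} | is_sublattice S && (A \subset S)) S.

Definition distributive_set (S : {set L}) : Prop :=
  {in S & &, forall x y z, x `&` (y `|` z) = (x `&` y) `|` (x `&` z)}.

(* w = (w_0, ..., w_n) is an M-chain of L; n is then the rank of L. *)
Definition is_Mchain (n : nat) (w : n.+1.-tuple L) : Prop :=
  [/\ tnth w ord0 = \bot, tnth w ord_max = \top, sorted covers w
    & forall K : {set L}, is_chain K ->
        distributive_set (gen_sublattice (K :|: [set x in w]))].

(* [find] returns the least index i such that x `|` w_i = y `|` w_i; one
   always exists when the last entry of w is \top. *)
Definition Mchain_label (n : nat) (w : n.+1.-tuple L) (x y : L) : nat :=
  find (fun v : L => x `|` v == y `|` v) w.

End Lattice.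

(* ---- The right weak order on S_n ---- *)

Definition inversions (n : nat) (u : 'S_n) : nat :=
  #|[set p : 'I_n * 'I_n | (p.1 < p.2)%N && (u p.2 < u p.1)%N]|.

(* Products in 'S_n are read from left to right, (s * u) i = u (s i), so the
   product u s_i with composition read from right to left, which swaps the
   entries of u in positions i and i+1, is tperm i (i+1) * u here. *)
Definition weak_step (n : nat) : rel 'S_n := fun u v =>
  [exists i : 'I_n, exists j : 'I_n,
    [&& (j == i.+1 :> nat), v == (tperm i j * u)%g
      & inversions v == (inversions u).+1]].

Definition weak_le (n : nat) : rel 'S_n := connect (@weak_step n).

(* One-line notation with entries in {1, ..., n}. *)
Definition one_line (n : nat) (u : 'S_n) : seq nat :=
  [seq (u i).+1 | i <- enum 'I_n].

(* ---- Intervals and isomorphisms ---- *)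

Definition rel_itv (T : finType) (r : rel T) (a b : T) : {set T} :=
  [set x | r a x && r x b].

(* f restricts to an isomorphism from (A, r) onto (B, s) *)
Definition rel_iso (T U : finType) (r : rel T) (s : rel U)
    (A : {set T}) (B : {set U}) (f : T -> U) : Prop :=
  [/\ f @: A = B, {in A &, injective f}
    & {in A &, {mono f : x y / r x y >-> s x y}}].

(* Main.v *)
Require Import Defs.
From mathcomp Require Import all_boot all_order all_fingroup zify.

Set Implicit Arguments.
Unset Strict Implicit.
Unset Printing Implicit Defensive.

Import Order.TTheory.
Local Open Scope order_scope.

(** The label map turns a polygon move into an adjacent transposition of the
    label sequence that creates one inversion ([move_adjacent_swap]).
    Conversely, at every descent of a maximal chain m' there is exactly one
    polygon move into m' ([adjacent_swap_lift], [polygon_moveP]): a descent x < y < z is replaced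
    by x < p < z, where p = z /\ (x \/ w_b) and b is the label of y < z.  So
    every path of the weak order that ends at the labels of m' lifts to a path
    of polygon moves that ends at m'.  What remains is that lifts of two paths
    with the same source end at the same chain, that is, that the label map is
    injective on the set of maximal chains below a given one; an interval is
    then carried bijectively onto the interval between the images of its ends,
    and the order is reflected.

    This injectivity comes from distributivity.  The element p is a lattice
    polynomial in x, z and the M-chain, so all the maximal chains below m lie in the sublattice D generated by m and the M-chain
    ([move_in_distributive]), and D is distributive.  In D an element x is
    determined by its jumps, the indices i for which x /\ w_i is not below
    w_(i-1) ([jumps_inj]); in Birkhoff's picture, where D consists of the order
    ideals of a poset of size n and w lists that poset along a linear extension,
    the jumps are the members of the ideal x.  A cover adds one jump, its label
    ([cover_jumps]), so the label sequence of a maximal chain in D gives the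
    jumps of each of its elements and hence the chain
    ([full_chain_labels_inj]).

    The lemma on covers also applies to any single cover of the lattice, because
    its two elements and the M-chain generate a distributive sublattice.  This
    gives that the labels of a maximal chain are a permutation of 1, ..., n, and
    that two saturated chains with the same ends have the same labels up to
    order, which settles the shape of the intervals [x, z] above a descent. *)

(** * Maximal chains of an interval as saturated sequences *)

Section SaturatedSequences.

Context {d : Order.disp_t} {T : finPOrderType d}.
Implicit Types (x y z t : T) (s : seq T) (c : {set T}).

Lemma coversP x y :
  reflect (x < y /\ forall z, x < z -> z < y -> False) (covers x y).
Proof.
apply: (iffP andP) => -[ltxy H]; split=> //.
  by move=> z xz zy; move/forallP/(_ z): H; rewrite xz zy.
by apply/forallP=> z; apply/negP=> /andP[xz zy]; exact: (H z).
Qed.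

Lemma covers_lt x y : covers x y -> x < y.
Proof. by case/coversP. Qed.

Lemma covers_between x y z :
  covers x y -> x <= z -> z <= y -> z = x \/ z = y.
Proof.
case/coversP=> _ H; rewrite le_eqVlt => /orP[/eqP->|xz]; first by left.
rewrite le_eqVlt => /orP[/eqP->|zy]; first by right.
by case: (H z).
Qed.

Lemma chainP c :
  reflect {in c &, forall x y, x >=< y} (is_chain c).
Proof.
apply: (iffP forall_inP) => H x => [y xc yc|xc].
  by move/forall_inP: (H x xc); apply.
by apply/forall_inP=> y; apply: H.
Qed.

Lemma covers_path_lt x s : path covers x s -> path <%O x s.
Proof. by apply: sub_path => a b /covers_lt. Qed.

Lemma lt_path_last x s : path <%O x s -> x <= last x s.
Proof.
elim: s x => //= y s IH x /andP[xy /IH]; apply: le_trans; exact: ltW.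
Qed.

Lemma lt_path_mem x s y :
  path <%O x s -> y \in x :: s -> (x <= y) && (y <= last x s).
Proof.
elim: s x => [|z s IH] x /= ; first by rewrite inE => _ /eqP->; rewrite lexx.
case/andP=> xz pz; rewrite inE => /predU1P[->|/(IH z pz)/andP[zy ->]].
  by rewrite lexx (le_trans (ltW xz)) // lt_path_last.
by rewrite (le_trans (ltW xz)).
Qed.

Lemma lt_path_chain x s : path <%O x s -> is_chain [set y in x :: s].
Proof.
move=> pxs; apply/chainP=> a b; rewrite !in_set => ha hb.
have lts: sorted <%O (x :: s) by [].
case/splitPr: ha lts hb => p1 p2.
rewrite sorted_pairwise; last exact: lt_trans.
rewrite pairwise_cat /= => /and3P[/allrelP H1 _ /andP[/allP H2 _]].
rewrite mem_cat inE => /or3P[bp|/eqP->|/H2 ab].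
- by rewrite ge_comparable // ltW // H1 // inE eqxx.
- exact: comparablexx.
- by rewrite le_comparable // ltW.
Qed.

Lemma sort_chain_lt c : is_chain c -> sorted <%O (sort <=%O (enum c)).
Proof.
move/chainP=> chc; rewrite lt_sorted_uniq_le sort_uniq enum_uniq /=.
apply: (@sort_sorted_in _ (mem c)).
  by move=> a b; apply: chc.
by apply/allP=> a; rewrite mem_enum.
Qed.

(** Lets a chain given by its increasing list of elements be read back from the
    set, as [label_seq] does. *)
Lemma sort_enum_lt_path x s :
  path <%O x s -> sort <=%O (enum [set y in x :: s]) = x :: s.
Proof.
move=> pxs; apply: lt_sorted_eq => //.
  exact/sort_chain_lt/lt_path_chain.
by move=> y; rewrite mem_sort mem_enum in_set.
Qed.

(** Any element comparable with all members of a saturated sequence falls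
    between two consecutive ones, hence coincides with one of them. *)
Lemma covers_path_max_chain x s :
  path covers x s -> max_chain_in (citv x (last x s)) [set y in x :: s].
Proof.
move=> pxs; have ltp := covers_path_lt pxs.
apply/maxsetP; split.
  rewrite lt_path_chain //=.
  by apply/subsetP=> y; rewrite !in_set => ys; apply: lt_path_mem.
move=> b /andP[/chainP chb /subsetP bsub] csub.
apply/eqP; rewrite eqEsubset csub andbT; apply/subsetP=> t tb.
have:= bsub t tb; rewrite !in_set.
have: {in x :: s, forall y, y >=< t}.
  move=> y ys; apply: chb => //; apply: (subsetP csub).
  by rewrite in_set.
elim: s x pxs {ltp csub bsub} => [|y s IH] x /=.
  by move=> _ _; rewrite inE eq_le andbC.
case/andP=> cxy pys cmp /andP[xt tl].
have/orP[yt|ty] := cmp y (mem_behead (s := x :: y :: s) (mem_head _ _)).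
  have:= IH y pys; rewrite yt tl => H; rewrite in_cons H ?orbT //.
  by move=> e es; apply: cmp; rewrite in_cons es orbT.
by case: (covers_between cxy xt ty) => ->; rewrite !inE eqxx ?orbT.
Qed.

(** By maximality a chain contains every element of the interval that is
    comparable with all its members: both ends, and anything strictly between
    two consecutive members. *)
Lemma max_chain_covers_path x z c : x <= z -> max_chain_in (citv x z) c ->
  exists2 s, sort <=%O (enum c) = x :: s & path covers x s /\ last x s = z.
Proof.
move=> xz /maxsetP[/andP[/chainP chc /subsetP csub] cmax].
have add t : x <= t -> t <= z -> {in c, forall y, y >=< t} -> t \in c.
  move=> xt tz cmp; rewrite -(cmax (t |: c)) ?subsetUr ?setU11 //.
  apply/andP; split; last first.
    by apply/subsetP=> y /setU1P[->|/csub//]; rewrite inE xt.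
  apply/chainP=> a b /setU1P[->|ac] /setU1P[->|bc].
  - exact: comparablexx.
  - by rewrite comparable_sym cmp.
  - exact: cmp.
  - exact: chc.
have xc: x \in c.
  by apply: add => // y /csub; rewrite inE => /andP[xy _]; apply: ge_comparable.
have zc: z \in c.
  by apply: add => // y /csub; rewrite inE => /andP[_ yz]; apply: le_comparable.
set S := sort _ _.
have memS y : (y \in S) = (y \in c) by rewrite mem_sort mem_enum.
have srt: sorted <%O S by apply/sort_chain_lt/chainP.
have cov: sorted covers S.
  apply/(sortedP x) => i iS.
  have pw: pairwise <%O S by rewrite -sorted_pairwise //; exact: lt_trans.
  have lti a b : (a < b)%N -> (b < size S)%N -> nth x S a < nth x S b.
    move=> ab bs; move/(pairwiseP x): pw; apply=> //.
    by rewrite inE (ltn_trans ab).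
  have iS' : (i < size S)%N by rewrite ltnW.
  apply/coversP; split; first exact: lti.
  move=> t it ti.
  have tc : t \in c.
    apply: add.
    - apply: le_trans (ltW it).
      by have:= csub (nth x S i); rewrite -memS mem_nth // inE => /(_ isT)/andP[].
    - apply: le_trans (ltW ti) _.
      by have:= csub (nth x S i.+1); rewrite -memS mem_nth // inE => /(_ isT)/andP[].
    move=> y; rewrite -memS => /(nthP x)[j jS <-].
    case: (leqP j i) => [|ij].
      rewrite leq_eqVlt => /predU1P[->|ji]; first by rewrite le_comparable // ltW.
      by rewrite le_comparable // ltW // (lt_trans _ it) // lti.
    rewrite ge_comparable // ltW //.
    move: ij; rewrite leq_eqVlt => /predU1P[<-//|ij].
    by rewrite (lt_trans ti) // lti.
  move: tc; rewrite -memS => /(nthP x)[j jS Et].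
  rewrite -Et in it ti.
  case: (ltngtP j i) => ji.
  - by have := lt_trans it (lti _ _ ji iS'); rewrite ltxx.
  - move: ji; rewrite leq_eqVlt => /predU1P[ji|ji]; first by rewrite ji ltxx in ti.
    by have := lt_trans ti (lti _ _ ji jS); rewrite ltxx.
  - by rewrite ji ltxx in it.
case: S memS srt cov => [|a s] memS srt cov; first by move: xc; rewrite -memS.
have Ea: a = x.
  apply/eqP; rewrite eq_le.
  have /andP[-> _] : (a <= x) && (x <= last a s).
    by apply: (lt_path_mem srt); rewrite memS.
  by have:= csub a; rewrite -memS mem_head inE => /(_ isT)/andP[].
rewrite Ea in memS srt cov *.
exists s => //; split=> //; apply/eqP; rewrite eq_le.
have /andP[_ ->] : (x <= z) && (z <= last x s).
  by apply: (lt_path_mem srt); rewrite memS.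
by have:= csub (last x s); rewrite -memS mem_last inE => /(_ isT)/andP[_ ->].
Qed.

Lemma covers_path_exists x z : x <= z ->
  exists2 s, path covers x s & last x s = z.
Proof.
move=> xz.
pose P b := is_chain b && (b \subset citv x z).
have [|c mc _] := @maxset_exists _ P set0.
  apply/andP; split; last exact: sub0set.
  by apply/chainP=> a; rewrite inE.
by have [s _ []] := max_chain_covers_path xz mc; exists s.
Qed.

End SaturatedSequences.

(** * Label sequences *)

Section Labels.

Context {A B : Type} (lam : A -> A -> B).

Definition edge_labels (s : seq A) : seq B :=
  [seq lam p.1 p.2 | p <- zip s (behead s)].

(** The element [x] belongs to one edge on each side, so it is repeated. *)
Lemma edge_labels_cat s1 x s2 :
  edge_labels (s1 ++ x :: s2) =
  edge_labels (rcons s1 x) ++ edge_labels (x :: s2).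
Proof.
rewrite /edge_labels.
elim: s1 => [|a [|b s1] IH] //=.
by move: IH => /= ->.
Qed.

Lemma edge_labels_split s t1 a b t2 :
    edge_labels s = t1 ++ a :: b :: t2 ->
  exists s1 x y z s2,
    [/\ s = s1 ++ x :: y :: z :: s2, edge_labels (rcons s1 x) = t1,
        lam x y = a, lam y z = b & edge_labels (z :: s2) = t2].
Proof.
elim: t1 s => [|e t1 IH] [|x [|y s]] //=.
  case: s => [|z s] //= [<- <- <-]; by exists [::], x, y, z, s.
case=> <- /IH[s1 [x' [y' [z' [s2 [E <- <- <- <-]]]]]].
exists (x :: s1), x', y', z', s2; split=> //; first by rewrite E.
by case: s1 E => [|c s1] /= [->].
Qed.

End Labels.

(** * The jump set of an element along the M-chain *)

Section Jumps.

Context {d : Order.disp_t} {L : finTBLatticeType d}.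
Variables (n : nat) (w : n.+1.-tuple L).
Hypothesis hw : is_Mchain w.
Implicit Types (x y z p : L) (D K : {set L}).

Local Notation lam := (Mchain_label w).

(** The M-chain, continued by the top element beyond its end, so that it is
    nondecreasing on all of [nat] and constant from [n] on. *)
Definition Mc (i : nat) : L := nth \top w i.

Lemma Mc0 : Mc 0 = \bot.
Proof. by case: hw => <- _ _ _; rewrite (tnth_nth \top). Qed.

Lemma Mc_top i : (n <= i)%N -> Mc i = \top.
Proof.
rewrite leq_eqVlt => /predU1P[<-|ni].
  by case: hw => _ <- _ _; rewrite (tnth_nth \top).
by rewrite /Mc nth_default // size_tuple.
Qed.

Lemma Mc_covers i : (i < n)%N -> covers (Mc i) (Mc i.+1).
Proof.
by case: hw => _ _ /(sortedP \top) H _ ni; apply: H; rewrite size_tuple.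
Qed.

Lemma Mc_mono i j : (i <= j)%N -> Mc i <= Mc j.
Proof.
move/subnK <-; elim: (j - i)%N => // k IH; rewrite addSn.
apply: le_trans IH _; case: (ltnP (k + i) n) => [/Mc_covers/covers_lt/ltW//|ni].
by rewrite (@Mc_top _.+1) ?lex1 // leqW.
Qed.

Lemma Mc_mem i : Mc i \in w.
Proof.
case: (ltnP i n.+1) => ni; first by rewrite mem_nth // size_tuple.
by rewrite (Mc_top (ltnW ni)) -(Mc_top (leqnn n)) mem_nth // size_tuple.
Qed.

(** The form in which the label is used: being equal after joining with [w_j]
    is monotone in [j], so the least index is characterized by an inequality. *)
Lemma label_le_join x y j : x <= y -> (lam x y <= j)%N = (y <= x `|` Mc j).
Proof.
move=> xy.
have E v : (x `|` v == y `|` v) = (y <= x `|` v).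
  apply/eqP/idP => [->|yx]; first exact: leUl.
  by apply/eqP; rewrite eq_le leU2 //= leUx yx leUr.
have hasw: has (fun v => x `|` v == y `|` v) w.
  by apply/hasP; exists (Mc n); rewrite ?Mc_mem // E (Mc_top (leqnn n)) joinx1 lex1.
apply/idP/idP => [le|].
  have := nth_find \top hasw; rewrite E => /le_trans; apply.
  by rewrite leU2 // Mc_mono.
apply: contraTT; rewrite -ltnNge => lt.
by have /= := before_find \top lt; rewrite E => ->.
Qed.

(** For x in a distributive lattice of order ideals, listed along the M-chain,
    these are the indices of the members of x.  No [i] outside 1, ..., n is a
    jump, since [Mc i] and [Mc i.-1] then coincide. *)
Definition jumps x : pred nat := fun i => ~~ (x `&` Mc i <= Mc i.-1).

Lemma jumps_bot : jumps \bot =1 pred0.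
Proof. by move=> i; rewrite /jumps meet0x le0x. Qed.

Lemma jumps_top i : jumps \top i = (1 <= i <= n)%N.
Proof.
rewrite /jumps meet1x; case: i => [|i] /=; first by rewrite lexx.
case: (ltnP i n) => [/Mc_covers/covers_lt/lt_geF->//|ni].
by rewrite (Mc_top ni) lex1.
Qed.

Definition Mc_distributive D :=
  [/\ {in D &, forall x y, x `&` y \in D}, {in D &, forall x y, x `|` y \in D},
      distributive_set D & forall i, Mc i \in D].

Lemma gen_Mc_distributive K : is_chain K ->
  Mc_distributive (gen_sublattice (K :|: [set x in w])).
Proof.
move=> chK; set D := gen_sublattice _.
have closed : {in D &, forall x y, (x `&` y \in D) && (x `|` y \in D)}.
  move=> x y /bigcapP xD /bigcapP yD.
  have H S : is_sublattice S && (K :|: [set x in w] \subset S) ->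
      (x `&` y \in S) && (x `|` y \in S).
    move=> HS; have [subS _] := andP HS.
    by move/forall_inP/(_ x (xD S HS))/forall_inP/(_ y (yD S HS)): subS.
  by apply/andP; split; apply/bigcapP=> S /H /andP[].
split.
- by move=> x y xD yD; case/andP: (closed x y xD yD).
- by move=> x y xD yD; case/andP: (closed x y xD yD).
- by case: hw => _ _ _; apply.
- move=> i; apply/bigcapP=> S /andP[_ /subsetP]; apply.
  by rewrite !inE Mc_mem orbT.
Qed.

Lemma sub_gen_sublattice K : K \subset gen_sublattice (K :|: [set x in w]).
Proof.
apply/subsetP=> x xK; apply/bigcapP=> S /andP[_ /subsetP]; apply.
by rewrite inE xK.
Qed.

Section InDistributive.

Variable D : {set L}.
Hypothesis hD : Mc_distributive D.

Let meetD x y : x \in D -> y \in D -> x `&` y \in D.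
Proof. by case: hD => H _ _ _; apply: H. Qed.
Let McD i : Mc i \in D.
Proof. by case: hD. Qed.
Let distrD x y z : x \in D -> y \in D -> z \in D ->
  x `&` (y `|` z) = (x `&` y) `|` (x `&` z).
Proof. by case: hD => _ _ H _; apply: H. Qed.

(** The right-hand side lies between [Mc i.-1] and [Mc i], which is a cover. *)
Lemma jump_join x i : jumps x i -> Mc i = Mc i.-1 `|` (x `&` Mc i).
Proof.
move=> jx.
have [i0 ni]: (0 < i)%N /\ (i.-1 < n)%N.
  case: i jx => [|i]; first by rewrite /jumps Mc0 meetx0 lexx.
  by rewrite /jumps /=; case: (ltnP i n) => // /Mc_top->; rewrite lex1.
have cov := Mc_covers ni; rewrite prednK // in cov.
case: (covers_between (z := Mc i.-1 `|` (x `&` Mc i)) cov) => [||E|//].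
- exact: leUl.
- by rewrite leUx leIr (ltW (covers_lt cov)).
- by case/negP: jx; rewrite -E leUr.
Qed.

(** The traces of [x] and [y] on the M-chain agree step by step: at a jump both
    [x `&` Mc i.+1] and [y `&` Mc i.+1] are complements of [Mc i] in the interval
    from their common previous trace to [Mc i.+1], and relative complements are
    unique in a distributive lattice. *)
Lemma jumps_inj : {in D &, forall x y, jumps x =1 jumps y -> x = y}.
Proof.
move=> x y xD yD E.
suff H i : x `&` Mc i = y `&` Mc i.
  by have := H n; rewrite (Mc_top (leqnn n)) !meetx1.
elim: i => [|i IH]; first by rewrite Mc0 !meetx0.
have half u v : u \in D -> v \in D -> u `&` Mc i = v `&` Mc i ->
    jumps u =1 jumps v -> u `&` Mc i.+1 <= v `&` Mc i.+1.
  move=> uD vD Euv J; have sub := Mc_mono (leqnSn i).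
  case: (boolP (jumps u i.+1)) => [ju|]; last first.
    rewrite /jumps negbK /= => le.
    by rewrite lexI leIr andbT (le_trans _ (leIl v (Mc i))) // -Euv lexI leIl.
  have jv := ju; rewrite J in jv; have Ev := jump_join jv; rewrite /= in Ev.
  rewrite {1}Ev distrD ?meetD // leUx {1}Euv leI2 //=.
  by apply: leIr.
by apply/le_anti; rewrite !half // => j; rewrite E.
Qed.

(** At indices below the label, [x] and [y] have the same trace on the M-chain;
    at an index [i] beyond it, [y] is below [x `|` Mc i.-1], which leaves no room
    for a jump of [y] that [x] does not have. *)
Lemma cover_jumps x y : x \in D -> y \in D -> covers x y ->
  jumps x (lam x y) = false /\
  (forall i, jumps y i = jumps x i || (i == lam x y)).
Proof.
move=> xD yD cxy; have ltxy := covers_lt cxy; have lexy := ltW ltxy.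
set a := lam x y.
have labE j : (a <= j)%N = ~~ (y `&` Mc j <= x).
  rewrite /a label_le_join //; apply/idP/idP => [le|nle].
    apply/negP=> le'.
    have: y <= x by rewrite -(meet_l le) distrD // leUx leIr.
    by rewrite lt_geF.
  have E : y `&` (x `|` Mc j) = x `|` (y `&` Mc j).
    by rewrite distrD // (meet_r lexy).
  case: (covers_between (z := y `&` (x `|` Mc j)) cxy) => [||E'|E'].
  - by rewrite lexI lexy leUl.
  - exact: leIl.
  - by move: nle; rewrite -{1}E' E leUr.
  - by rewrite -E' leIr.
have a0: (0 < a)%N by rewrite ltnNge labE Mc0 meetx0 le0x.
have pa: (a.-1 < a)%N by rewrite prednK.
have low j : (j < a)%N -> y `&` Mc j = x `&` Mc j.
  rewrite ltnNge labE negbK => le; apply/le_anti.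
  by rewrite lexI le leIr leI2.
have nx: jumps x a = false.
  apply: (introF idP) => jx; have:= leqnn a; rewrite labE => /negP; apply.
  rewrite (jump_join jx) distrD ?meetD // leUx low // leIl /=.
  by rewrite meetA (le_trans (leIl _ _)) // leIr.
split=> // i; case: (ltngtP i a) => ia.
- have ia': (i.-1 < a)%N by rewrite (leq_ltn_trans (leq_pred _)).
  by rewrite orbF /jumps low.
- rewrite orbF /jumps; congr (~~ _); apply/idP/idP => [|le].
    by apply: le_trans; rewrite leI2.
  have ai : (a <= i.-1)%N by case: (i) ia.
  have yle: y <= x `|` Mc i.-1 by rewrite -label_le_join.
  have: y `&` Mc i <= Mc i `&` (x `|` Mc i.-1).
    by rewrite lexI leIr (le_trans _ yle) // leIl.
  move/le_trans; apply.
  by rewrite distrD // leUx meetC le leIr.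
- rewrite ia orbT; apply/negP=> le; have:= leqnn a; rewrite labE => /negP; apply.
  rewrite (le_trans _ (leIl x (Mc a.-1))) // -low // lexI leIl //=.
Qed.

End InDistributive.

(** The pair [x], [y] is itself a chain, so it generates with the M-chain a
    distributive sublattice. *)
Lemma covers_jumps x y : covers x y ->
  jumps x (lam x y) = false /\
  (forall i, jumps y i = jumps x i || (i == lam x y)).
Proof.
move=> cxy; pose K := [set x; y].
have chK: is_chain K.
  have cmp: x >=< y by rewrite le_comparable // ltW // covers_lt.
  apply/chainP=> a b /set2P[] -> /set2P[] -> //; rewrite ?comparablexx //.
  by rewrite comparable_sym.
have /subsetP sub := sub_gen_sublattice K.
apply: (cover_jumps (gen_Mc_distributive chK)) => //; apply: sub.
  exact: set21.
exact: set22.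
Qed.

Lemma path_jumps x s : path covers x s ->
  [/\ uniq (edge_labels lam (x :: s)),
      {in edge_labels lam (x :: s), forall i, jumps x i = false}
    & forall i, jumps (last x s) i =
                jumps x i || (i \in edge_labels lam (x :: s))].
Proof.
elim: s x => [|y s IH] x /=; first by split=> // i; rewrite orbF.
case/andP=> cxy /IH[us ns Es]; have [nx Ey] := covers_jumps cxy.
rewrite -/(edge_labels lam (y :: s)); split.
- rewrite us andbT; apply/negP=> /ns.
  by rewrite Ey eqxx orbT.
- move=> i; rewrite inE => /predU1P[->//|/ns].
  by rewrite Ey; case: (jumps x i).
- by move=> i; rewrite Es Ey inE orbA.
Qed.

(** Both sides list the jumps of the upper end that are not jumps of the lower
    end. *)
Lemma path_labels_perm x s t : path covers x s -> path covers x t ->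
  last x s = last x t ->
  perm_eq (edge_labels lam (x :: s)) (edge_labels lam (x :: t)).
Proof.
move=> /path_jumps[us ns Es] /path_jumps[ut nt Et] E.
apply: uniq_perm => // i; apply/idP/idP => [/[dup]/ns jx|/[dup]/nt jx] im.
  by have := Et i; rewrite -E Es jx im.
by have := Es i; rewrite E Et jx im.
Qed.

Lemma size_edge_labels x s : size (edge_labels lam (x :: s)) = size s.
Proof. by rewrite size_map size_zip /= minnC; apply/minn_idPl. Qed.

Lemma path_size x s t : path covers x s -> path covers x t ->
  last x s = last x t -> size s = size t.
Proof.
move=> ps pt E; rewrite -!(size_edge_labels x).
exact/perm_size/path_labels_perm.
Qed.

Lemma max_path_labels s : path covers \bot s -> last \bot s = \top ->
  perm_eq (edge_labels lam (\bot :: s)) (iota 1 n).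
Proof.
move=> /path_jumps[us _ Es] E; apply: uniq_perm; rewrite ?iota_uniq // => i.
by have:= Es i; rewrite E jumps_top jumps_bot mem_iota add1n ltnS /= => <-.
Qed.

(** * Flipping a descent *)

(** The middle element of the ascending chain of [x, z] when x < y < z is a
    descent: the part of [z] that is reached from [x] by means of the smaller of
    the two labels. *)
Definition flip x y z : L := z `&` (x `|` Mc (lam y z)).

Section Descent.

Variables x y z : L.
Hypothesis desc : is_descent lam x y z.
Let p := flip x y z.

Let cxy : covers x y. Proof. by case/and3P: desc. Qed.
Let cyz : covers y z. Proof. by case/and3P: desc. Qed.
Let ltb : (lam y z < lam x y)%N.
Proof. by case/and3P: desc => _ _; rewrite leEnat -ltnNge. Qed.
Let lexy := ltW (covers_lt cxy).
Let leyz := ltW (covers_lt cyz).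
Let lexz := le_trans lexy leyz.

Lemma flip_lt : p < z.
Proof.
rewrite lt_neqAle leIl andbT; apply/eqP => E.
have : y <= x `|` Mc (lam y z).
  by rewrite (le_trans leyz) // -{1}E /p /flip leIr.
by rewrite -label_le_join // leqNgt ltb.
Qed.

(** If [x = p] then [z `&` Mc (lam y z)] is below [y], and distributivity
    in the sublattice generated by [y], [z] and the M-chain forces
    [z <= y]. *)
Lemma lt_flip : x < p.
Proof.
rewrite lt_neqAle lexI lexz leUl !andbT; apply/eqP => E.
have: z `&` Mc (lam y z) <= y.
  by rewrite (le_trans _ lexy) // E leI2 // leUr.
pose K := [set y; z].
have chK: is_chain K.
  have cmp: y >=< z by rewrite le_comparable.
  apply/chainP=> a b /set2P[] -> /set2P[] -> //; rewrite ?comparablexx //.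
  by rewrite comparable_sym.
have /subsetP sub := sub_gen_sublattice K.
have [_ _ dD MD] := gen_Mc_distributive chK.
have zy : z <= y `|` Mc (lam y z) by rewrite -label_le_join.
move=> le; have: z <= y.
  rewrite -(meet_l zy) dD ?MD // ?sub ?set21 ?set22 //.
  by rewrite leUx leIr.
by rewrite lt_geF // covers_lt.
Qed.

Let pathxyz : path covers x [:: y; z].
Proof. by rewrite /= cxy cyz. Qed.

(** Saturated chains with the same ends have the same length, and [x], [y], [z]
    has length two. *)
Lemma flip_covers : covers x p /\ covers p z.
Proof.
have [s ps Es] := covers_path_exists (ltW lt_flip).
have [t pt Et] := covers_path_exists (ltW flip_lt).
have pst : path covers x (s ++ t) by rewrite cat_path ps Es.
have := path_size pst pathxyz; rewrite last_cat Es Et => /(_ erefl).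
case: s ps Es {pst} => [_ /= E|a s ps Es]; first by have:= lt_flip; rewrite -E ltxx.
case: t pt Et => [_ /= E|b t pt Et]; first by have:= flip_lt; rewrite E ltxx.
rewrite size_cat /= addnS; case=> /eqP; rewrite addn_eq0 => /andP[/nilP s0 /nilP t0].
move: ps Es pt Et; rewrite s0 t0 /= !andbT => ca Ea cb Eb.
by rewrite Ea in ca; rewrite Eb in cb; split.
Qed.

Let two_step_labels q : covers x q -> covers q z ->
  perm_eq [:: lam x q; lam q z] [:: lam x y; lam y z].
Proof.
move=> cxq cqz.
apply: (@path_labels_perm x [:: q; z] [:: y; z]) => //=.
by rewrite cxq cqz.
Qed.

Lemma flip_labels : lam x p = lam y z /\ lam p z = lam x y.
Proof.
have [cxp cpz] := flip_covers.
have /perm_mem E := two_step_labels cxp cpz.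
have le : (lam x p <= lam y z)%N.
  by rewrite label_le_join ?(ltW (covers_lt cxp)) // leIr.
have := E (lam x p); rewrite !inE eqxx /= => /esym/orP[]/eqP Exp.
  by move: le; rewrite Exp leqNgt ltb.
split=> //; have := E (lam x y); rewrite !inE eqxx Exp (gtn_eqF ltb) /=.
by move/eqP.
Qed.

Lemma flip_neq : p != y.
Proof.
by apply/eqP=> E; have [Exp _] := flip_labels; move: ltb; rewrite -Exp E ltnn.
Qed.

(** An ascending chain starts with the smaller label, which puts [q] below both
    [z] and [x `|` Mc (lam y z)], hence below [p]. *)
Lemma flip_unique q :
  covers x q -> covers q z -> (lam x q <= lam q z)%N -> q = p.
Proof.
move=> cxq cqz asc; have /perm_mem E := two_step_labels cxq cqz.
have := E (lam x q); rewrite !inE eqxx /= => /esym/orP[]/eqP Exq.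
  have := E (lam y z); rewrite !inE eqxx orbT Exq (ltn_eqF ltb) /= => /eqP Eqz.
  by move: asc; rewrite Exq -Eqz leqNgt ltb.
have qp : q <= p.
  rewrite lexI (ltW (covers_lt cqz)) -label_le_join ?Exq //=.
  exact/ltW/covers_lt.
case: (covers_between cqz qp (ltW flip_lt)) => // E'.
by have := flip_lt; rewrite E' ltxx.
Qed.

Lemma flip_unique_ascending : unique_ascending lam x z [set x; p; z].
Proof.
have [cxp cpz] := flip_covers.
have set3 q : [set x; q; z] = [set t in [:: x; q; z]].
  by apply/setP=> t; rewrite !inE orbA.
apply/eqP/setP=> c; rewrite in_set in_set1; apply/andP/eqP => [[mc asc]|->].
  have [s Es [ps ls]] := max_chain_covers_path lexz mc.
  have := path_size ps pathxyz ls.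
  case: s Es ps ls => [|q [|z' [|]]] //= Es /and3P[cxq cqz _] Ez _.
  rewrite Ez in Es cqz.
  have Eq : q = p.
    apply: flip_unique => //.
    by move: asc; rewrite /ascending /label_seq Es /= andbT leEnat.
  rewrite set3 -Eq -Es; apply/setP=> t.
  by rewrite in_set mem_sort mem_enum.
have pp : path covers x [:: p; z] by rewrite /= cxp cpz.
rewrite set3; split; first exact: (covers_path_max_chain pp).
rewrite /ascending /label_seq sort_enum_lt_path ?covers_path_lt //=.
by case: flip_labels => -> ->; rewrite leEnat ltnW.
Qed.

Lemma chain_citv_covers c : is_chain c -> x \in c -> y \in c -> z \in c ->
  c :&: citv x z = [set x; y; z].
Proof.
move=> /chainP chc xc yc zc; apply/setP=> t; rewrite !inE.
apply/and3P/idP => [[tc xt tz]|].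
  have/orP[ty|yt] := chc t y tc yc.
    by case: (covers_between cxy xt ty) => ->; rewrite eqxx ?orbT.
  by case: (covers_between cyz yt tz) => ->; rewrite eqxx ?orbT.
by case/orP=> [/orP[]|] /eqP->; rewrite ?lexx ?lexy ?leyz ?lexz.
Qed.

Lemma flip_polygon_move c : is_chain c -> x \in c -> y \in c -> z \in c ->
  polygon_move_set lam (p |: (c :\ y)) c.
Proof.
move=> chc xc yc zc; have E := chain_citv_covers chc xc yc zc.
have [ltxp ltpz] := (lt_flip, flip_lt); have npy := flip_neq.
have [ltxy ltyz] := (covers_lt cxy, covers_lt cyz).
have ltxz := lt_trans ltxy ltyz.
apply/existsP; exists x; apply/existsP; exists z.
have -> : (p |: (c :\ y)) :&: citv x z = [set x; p; z].
  apply/setP=> t; have /setP/(_ t) := E; rewrite !inE.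
  have [->|_] := eqVneq t p; first by rewrite !ltW ?orbT.
  have [->|_] := eqVneq t y; first by rewrite (gt_eqF ltxy) (lt_eqF ltyz).
  by rewrite /= orbF.
rewrite ltxz flip_unique_ascending.
have -> : x \in (p |: (c :\ y)) :&: c by rewrite !inE xc (lt_eqF ltxy) !orbT.
have -> : z \in (p |: (c :\ y)) :&: c by rewrite !inE zc (gt_eqF ltyz) !orbT.
rewrite /=; apply/and3P; split=> //.
- apply/eqP/setP=> t; rewrite !inE.
  have [->|_] := eqVneq t p; first by rewrite (lt_geF ltxp) !andbF.
  by have [->|//] := eqVneq t y; rewrite (lt_geF ltxy) !andbF.
- apply/eqP; apply/setP=> t; rewrite !inE.
  have [->|_] := eqVneq t p; first by rewrite (lt_geF ltpz) !andbF.
  by have [->|//] := eqVneq t y; rewrite (lt_geF ltyz) !andbF.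
- by apply/existsP; exists y; rewrite desc E eqxx !inE eqxx eq_sym (negbTE npy).
Qed.

End Descent.

(** The lower chain of a polygon move is determined by the upper chain and the
    descent, because the ascending chain of [x, z] is. *)
Lemma polygon_move_flip c c' : is_chain c -> is_chain c' ->
    polygon_move_set lam c c' ->
  exists x y z, [/\ is_descent lam x y z, [/\ x \in c', y \in c' & z \in c']
                  & c = flip x y z |: (c' :\ y)].
Proof.
move=> /chainP chc /chainP chc' /existsP[x /existsP[z /and5P[ltxz]]].
rewrite !inE => /andP[xc xc'] /andP[zc zc'] /eqP/setP below.
case/and3P=> /eqP/setP above ua /existsP[y /and3P[desc yc /eqP/setP E']].
exists x, y, z; have [cxy cyz _] := and3P desc.
have [ltxy ltyz] := (covers_lt cxy, covers_lt cyz).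
have yc' : y \in c' by have := E' y; rewrite !inE eqxx orbT /= => /andP[].
have /setP E : c :&: citv x z = [set x; flip x y z; z].
  move: ua (flip_unique_ascending desc); rewrite /unique_ascending => /eqP-> /eqP.
  exact: set1_inj.
split=> //; apply/setP=> t; rewrite !inE.
have {}below := below t; have {}above := above t; have {}E := E t; have {}E' := E' t.
rewrite !inE in below above E E'.
have [Et|ntp] := eqVneq t (flip x y z).
  by move: E; rewrite Et eqxx orbT /= => /andP[].
have [Et|nty] := eqVneq t y; first by rewrite Et (negbTE yc).
rewrite (negbTE ntp) orbF in E; rewrite (negbTE nty) orbF in E'.
have key (b : {set L}) : {in b &, forall u v, u >=< v} -> x \in b -> z \in b -> t \in b ->
    [|| t <= x, z <= t | x <= t <= z].
  move=> chb xb zb tb; have/orP[->//|xt] := chb t x tb xb.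
  by have/orP[tz|->] := chb t z tb zb; rewrite ?xt ?tz ?orbT.
rewrite /=; apply/idP/idP => tc.
  have/or3P[tx|zt|xtz] := key c chc xc zc tc.
  - by move: below; rewrite tc tx /= => /esym/andP[].
  - by move: above; rewrite tc zt /= => /esym/andP[].
  - by move: E E'; rewrite tc xtz /= => <- /andP[].
have/or3P[tx|zt|xtz] := key c' chc' xc' zc' tc.
- by move: below; rewrite tc tx /= => /andP[].
- by move: above; rewrite tc zt /= => /andP[].
- by move: E E'; rewrite tc xtz /= => + /esym H; rewrite H => /andP[].
Qed.

(** * Polygon moves as adjacent transpositions of labels *)

(** Maximal chains as lists; with [ohead] the empty list is excluded even when
    the lattice has a single element. *)
Definition full_chain (l : seq L) : Prop :=
  [/\ sorted covers l, ohead l = Some \bot & last \bot l = \top].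

Lemma citv_bot_top : citv \bot \top = [set: L].
Proof. by apply/setP=> x; rewrite !inE le0x lex1. Qed.

Lemma full_chain_sort c :
  max_chain_in [set: L] c -> full_chain (sort <=%O (enum c)).
Proof.
rewrite -citv_bot_top => /max_chain_covers_path -/(_ (le0x _))[s -> []].
by split.
Qed.

Lemma full_chain_max l : full_chain l ->
  max_chain_in [set: L] [set x in l] /\ sort <=%O (enum [set x in l]) = l.
Proof.
case: l => [|x s] [ps //= [xE] lE]; rewrite {}xE /= in ps lE *.
split; last exact/sort_enum_lt_path/covers_path_lt.
by rewrite -citv_bot_top -lE; apply: covers_path_max_chain.
Qed.

Lemma full_chain_labels l :
  full_chain l -> perm_eq (edge_labels lam l) (iota 1 n).
Proof.
case: l => [|x s] [ps //= [xE] lE]; rewrite {}xE /= in ps lE *.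
exact: max_path_labels.
Qed.

Lemma full_chain_replace s1 x y p z s2 :
  full_chain (s1 ++ [:: x, y, z & s2]) -> covers x p -> covers p z ->
  full_chain (s1 ++ [:: x, p, z & s2]).
Proof.
case: s1 => [|a s1] [/= ps h l] cxp cpz; split=> //=.
- by case/and3P: ps => _ _ ->; rewrite cxp cpz.
- move: ps; rewrite !cat_path /= cxp cpz.
  by case/and3P=> -> -> /and3P[_ _ ->].
- by move: l; rewrite !last_cat.
Qed.

(** In a saturated list the successor of [x] is the only listed cover of [x]. *)
Lemma consecutive_in_full_chain l x y z : full_chain l ->
  x \in l -> y \in l -> z \in l -> covers x y -> covers y z ->
  exists s1 s2, l = s1 ++ [:: x, y, z & s2].
Proof.
case=> srt _ _ xl yl zl cxy cyz.
have next s1 (a b : L) r : sorted covers (s1 ++ a :: r) -> b \in s1 ++ a :: r ->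
    covers a b -> exists r', r = b :: r'.
  move=> cov bin cab; have ltab := covers_lt cab.
  have: sorted <%O (s1 ++ a :: r) by apply: sub_sorted cov => u v /covers_lt.
  rewrite sorted_pairwise; last exact: lt_trans.
  rewrite pairwise_cat /= => /and3P[/allrelP H _ _].
  have {}cov : path covers a r.
    by case: (s1) cov => [|c s0] //=; rewrite cat_path /= => /and3P[].
  move: bin; rewrite mem_cat => /orP[bin|].
    by have := H b a bin (mem_head _ _) => /lt_trans/(_ ltab); rewrite ltxx.
  rewrite inE => /predU1P[E|]; first by rewrite E ltxx in ltab.
  case: r cov {H} => [//|e r] /= /andP[cae per] bin.
  have /andP[eb _] := lt_path_mem (covers_path_lt per) bin.
  case: (covers_between cab (ltW (covers_lt cae)) eb) => E.
    by have := covers_lt cae; rewrite E ltxx.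
  by exists r; rewrite E.
case/splitPr: xl srt yl zl => s1 r srt yl zl.
have [r' E] := next _ _ _ _ srt yl cxy; rewrite {}E in srt yl zl *.
rewrite -cat_rcons in srt zl.
have [s2 ->] := next _ _ _ _ srt zl cyz.
by exists s1, s2.
Qed.

Lemma replace_set s1 x y p z s2 : full_chain (s1 ++ [:: x, y, z & s2]) ->
  [set t in s1 ++ [:: x, p, z & s2]] =
  p |: ([set t in s1 ++ [:: x, y, z & s2]] :\ y).
Proof.
case=> srt _ _.
have: uniq (s1 ++ [:: x, y, z & s2]).
  by apply: lt_sorted_uniq; apply: sub_sorted srt => u v /covers_lt.
rewrite (uniq_catCA s1 [:: x; y]) /= inE negb_or => /and3P[/andP[nxy _] ny _].
apply/setP=> t; rewrite !inE !mem_cat !inE.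
have [->|ntp] := eqVneq t p; first by rewrite !orbT.
have [->|nty] //= := eqVneq t y.
by rewrite (eq_sym y x) (negbTE nxy); move: ny; rewrite mem_cat inE => /negbTE.
Qed.

Lemma polygon_moveP c c' :
    max_chain_in [set: L] c -> max_chain_in [set: L] c' ->
  polygon_move_set lam c c' <->
  exists s1 x y z s2, [/\ is_descent lam x y z,
    sort <=%O (enum c') = s1 ++ [:: x, y, z & s2]
    & sort <=%O (enum c) = s1 ++ [:: x, flip x y z, z & s2]].
Proof.
move=> mc mc'; have [/andP[chc _] _] := maxsetP mc.
have [/andP[chc' _] _] := maxsetP mc'.
have setE (b : {set L}) : b = [set t in sort <=%O (enum b)].
  by apply/setP=> t; rewrite in_set mem_sort mem_enum.
have full := full_chain_sort mc'.
split=> [mv|[s1 [x [y [z [s2 [desc Ec' Ec]]]]]]].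
  have [x [y [z [desc [xc yc zc] E]]]] := polygon_move_flip chc chc' mv.
  have [cxy cyz _] := and3P desc.
  have [s1 [s2 Ec']] : exists s1 s2, sort <=%O (enum c') = s1 ++ [:: x, y, z & s2].
    by apply: consecutive_in_full_chain; rewrite ?mem_sort ?mem_enum.
  exists s1, x, y, z, s2; split=> //; rewrite Ec' in full.
  have [cxp cpz] := flip_covers desc.
  have [_ <-] := full_chain_max (full_chain_replace full cxp cpz).
  by rewrite E (replace_set _ full) -Ec' -setE.
have inc' t : t \in [:: x, y, z & s2] -> t \in c'.
  by move=> ts; rewrite (setE c') in_set Ec' mem_cat ts orbT.
rewrite [X in polygon_move_set _ X _]setE Ec; rewrite Ec' in full.
rewrite (replace_set _ full) -Ec' -setE.
by apply: flip_polygon_move; rewrite // inc' // !inE eqxx ?orbT.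
Qed.

(** Climbing both chains from the bottom, equal labels give equal jumps, and in
    [D] equal jumps give equal elements. *)
Lemma full_chain_labels_inj D l l' : Mc_distributive D ->
  full_chain l -> full_chain l' -> {subset l <= D} -> {subset l' <= D} ->
  edge_labels lam l = edge_labels lam l' -> l = l'.
Proof.
move=> hD; case: l => [|x s] [ps //= [xE] _]; rewrite {}xE /= in ps *.
case: l' => [|x' s'] [ps' //= [xE'] _]; rewrite {}xE' /= in ps' *.
elim: s s' \bot ps ps' => [|y s IH] [|y' s'] a //=.
case/andP=> cxy ps /andP[cxy' ps'] sD sD' [E Es].
have [_ Jy] := covers_jumps cxy; have [_ Jy'] := covers_jumps cxy'.
have Ey : y = y'.
  apply: (jumps_inj hD); first by apply: sD; rewrite !inE eqxx orbT.
    by apply: sD'; rewrite !inE eqxx orbT.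
  by move=> i; rewrite Jy Jy' E.
rewrite -{}Ey in ps' sD' Es *; congr (_ :: _); apply: IH => //.
- by move=> t ts; apply: sD; rewrite inE ts orbT.
- by move=> t ts; apply: sD'; rewrite inE ts orbT.
Qed.

End Jumps.

(** The common shadow of polygon moves and of weak order steps on sequences. *)
Definition adjacent_swap (s t : seq nat) : Prop :=
  exists s1 a b s2,
    [/\ (a < b)%N, s = s1 ++ [:: a, b & s2] & t = s1 ++ [:: b, a & s2]].

Section MaximalChains.

Context {d : Order.disp_t} {L : finTBLatticeType d}.
Variables (n : nat) (w : n.+1.-tuple L).
Hypothesis hw : is_Mchain w.
Implicit Types (m : maxchain L) (D : {set L}).

Local Notation lam := (Mchain_label w).
Local Notation labels m := (label_seq lam (val m)).
Local Notation move := (polygon_move lam).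

Lemma move_adjacent_swap m m' :
  move m m' -> adjacent_swap (labels m) (labels m').
Proof.
case/(polygon_moveP hw (valP m) (valP m'))=> s1 [x [y [z [s2 [desc E' E]]]]].
have [E1 E2] := flip_labels hw desc.
rewrite /label_seq E E' -!/(edge_labels lam _) !(edge_labels_cat _ s1).
exists (edge_labels lam (rcons s1 x)), (lam y z), (lam x y), (edge_labels lam (z :: s2)).
split; last by [].
  by case/and3P: desc => _ _; rewrite leEnat -ltnNge.
by rewrite -E1 -E2.
Qed.

(** The two entries swapped in [labels m'] are those of a descent of [m'],
    which can be flipped. *)
Lemma adjacent_swap_lift t m' : adjacent_swap t (labels m') ->
  exists2 m, move m m' & labels m = t.
Proof.
case=> t1 [a [b [t2 [ab -> E']]]].
have [s1 [x [y [z [s2 [Es Et1 Eb Ea Et2]]]]]] := edge_labels_split E'.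
have full := full_chain_sort (valP m'); rewrite Es in full.
have [cxy cyz] : covers x y /\ covers y z.
  case: full => + _ _; case: (s1) => [|e s0] /=; first by case/and3P.
  by rewrite cat_path /= => /and5P[].
have desc : is_descent lam x y z.
  by rewrite /is_descent cxy cyz Eb Ea leEnat -ltnNge.
have [cxp cpz] := flip_covers hw desc.
have [mc Ec] := full_chain_max (full_chain_replace full cxp cpz).
pose m : maxchain L := exist (fun c => max_chain_in [set: L] c) _ mc; exists m.
  by apply/(polygon_moveP hw mc (valP m')); exists s1, x, y, z, s2; split.
have [E1 E2] := flip_labels hw desc.
rewrite /label_seq /= Ec -!/(edge_labels lam _) edge_labels_cat Et1.
by rewrite -Ea -Eb -Et2 -E1 -E2.
Qed.

(** The new element is a lattice polynomial in two elements of [m'] and one of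
    the M-chain. *)
Lemma move_in_distributive D m m' : Mc_distributive w D ->
  move m m' -> val m' \subset D -> val m \subset D.
Proof.
move=> [mD jD _ MD] /(polygon_move_flip hw)-[||x [y [z [_ [xm ym zm] ->]]]].
- by have /maxsetP[/andP[]] := valP m.
- by have /maxsetP[/andP[]] := valP m'.
move/subsetP=> sub; apply/subsetP=> t /setU1P[->|/setD1P[_ /sub//]].
by apply: (mD _ _ (sub _ zm)); apply: (jD _ _ (sub _ xm)); apply: MD.
Qed.

(** All chains below [m] live in the distributive sublattice generated by [m]
    and the M-chain, where labels determine the chain. *)
Lemma mcd_le_labels_inj m1 m2 m : mcd_le lam m1 m -> mcd_le lam m2 m ->
  labels m1 = labels m2 -> m1 = m2.
Proof.
have /maxsetP[/andP[chm _] _] := valP m.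
have hD := gen_Mc_distributive hw chm; have subD := sub_gen_sublattice w (val m).
set D := gen_sublattice _ in hD subD.
have below m' : mcd_le lam m' m -> val m' \subset D.
  case/connectP=> p; elim: p m' => [|a p IH] m' /=; first by move=> _ <-.
  case/andP=> mv pp E; apply: (move_in_distributive hD mv); exact: IH.
have subsort m' : mcd_le lam m' m -> {subset sort <=%O (enum (val m')) <= D}.
  by move=> /below/subsetP sub t; rewrite mem_sort mem_enum; apply: sub.
move=> le1 le2 E; apply: val_inj; apply/setP=> t.
have := full_chain_labels_inj hw hD (full_chain_sort (valP m1))
  (full_chain_sort (valP m2)) (subsort _ le1) (subsort _ le2) E.
by move=> Es; rewrite -mem_enum -(mem_sort <=%O) Es mem_sort mem_enum.
Qed.

Lemma labels_perm m : perm_eq (labels m) (iota 1 n).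
Proof. exact/full_chain_labels/full_chain_sort/valP. Qed.

End MaximalChains.

(** * Weak order steps in one-line notation *)

Section WeakOrder.

Variable n : nat.
Implicit Types (u v : 'S_n) (i j : 'I_n).

Lemma one_line_inj : injective (@one_line n).
Proof.
move=> u v /eq_in_map E; apply/permP=> i; apply: val_inj.
by have [] := E i (mem_enum _ _).
Qed.

Lemma one_line_exists s : perm_eq s (iota 1 n) -> exists u, one_line u = s.
Proof.
move=> ps; have sz : size s = n by rewrite (perm_size ps) size_iota.
have us : uniq s by rewrite (perm_uniq ps) iota_uniq.
have ms k : (k < n)%N -> (0 < nth 0%N s k <= n)%N.
  move=> kn; have := @mem_nth _ 0%N s k; rewrite sz => /(_ kn).
  by rewrite (perm_mem ps) mem_iota add1n ltnS.
have lt i : ((nth 0%N s i).-1 < n)%N.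
  by have := ms i (ltn_ord i); case: (nth _ _ _).
have finj : injective (fun i => Ordinal (lt i)).
  move=> i j [] E; apply: val_inj; apply/eqP.
  rewrite -(nth_uniq 0%N _ _ us) ?sz ?ltn_ord //.
  move: E (ms i (ltn_ord i)) (ms j (ltn_ord j)).
  by case: (nth _ _ _) => // a; case: (nth _ _ _) => // b /= ->.
exists (perm finj); apply: (@eq_from_nth _ 0%N); rewrite size_map size_enum_ord //.
move=> k kn; rewrite (nth_map (Ordinal kn)) ?size_enum_ord // permE /=.
rewrite (nth_enum_ord _ kn) prednK //.
by case/andP: (ms k kn).
Qed.

Lemma enum_ord_split i j : j = i.+1 :> nat ->
  enum 'I_n = take i (enum 'I_n) ++ [:: i, j & drop i.+2 (enum 'I_n)].
Proof.
move=> E; rewrite -{1}(cat_take_drop i (enum 'I_n)).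
rewrite (drop_nth i) ?size_enum_ord // nth_ord_enum.
by rewrite (drop_nth i) -?E ?size_enum_ord // nth_ord_enum.
Qed.

Lemma one_line_split u i j : j = i.+1 :> nat ->
  exists s1 s2, [/\ size s1 = i, one_line u = s1 ++ [:: (u i).+1, (u j).+1 & s2]
    & one_line (tperm i j * u) = s1 ++ [:: (u j).+1, (u i).+1 & s2]].
Proof.
move=> E; have Ee := enum_ord_split E.
set e1 := take _ _ in Ee; set e2 := drop _ _ in Ee.
have := enum_uniq 'I_n; rewrite Ee (uniq_catCA e1 [:: i; j]) /=.
rewrite !inE !negb_or !mem_cat !negb_or => /and3P[/and3P[nij i1 i2] /andP[j1 j2] _].
have fix_ k : k != i -> k != j -> ((tperm i j * u)%g k).+1 = (u k).+1.
  by move=> ki kj; rewrite permM tpermD // eq_sym.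
exists [seq (u k).+1 | k <- e1], [seq (u k).+1 | k <- e2]; split.
- by rewrite size_map size_takel // size_enum_ord ltnW.
- by rewrite /one_line Ee map_cat.
rewrite /one_line Ee map_cat /= !permM tpermL tpermR.
by congr (_ ++ [:: _, _ & _]); apply/eq_in_map=> k ke; apply: fix_;
  apply: contraTneq ke => ->.
Qed.

(** Transposing the two adjacent positions preserves the order of every pair of
    positions except the pair (i, j) itself, which becomes an inversion. *)
Lemma inversions_swap u i j : j = i.+1 :> nat -> (u i < u j)%N ->
  inversions (tperm i j * u) = (inversions u).+1.
Proof.
move=> E lt; set v := (_ * u)%g.
pose f (p : 'I_n * 'I_n) := (tperm i j p.1, tperm i j p.2).
have finj : injective f.
  by move=> [a b] [a' b'] [/perm_inj-> /perm_inj->].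
have vE a : v a = u (tperm i j a) by rewrite permM.
set I := [set p : 'I_n * 'I_n | (p.1 < p.2)%N && (u p.2 < u p.1)%N].
have -> : inversions v = #|(i, j) |: f @^-1: I|.
  congr #|pred_of_set _|; apply/setP=> -[a b].
  rewrite !inE /= !vE xpair_eqE.
  rewrite -!(inj_eq val_inj) /=.
  by case: (tpermP i j a) => [->|->|/eqP + /eqP];
    case: (tpermP i j b) => [->|->|/eqP + /eqP];
    rewrite -?(inj_eq val_inj) /=; lia.
rewrite cardsU1 card_preimset // inE !inE /= tpermL tpermR.
by rewrite E ltnNge leqnSn.
Qed.

(** A step of the weak order requires the inversion number to grow, which
    excludes swapping two entries that are already in decreasing order. *)
Lemma weak_stepP u v :
  weak_step u v <-> adjacent_swap (one_line u) (one_line v).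
Proof.
split=> [/existsP[i /existsP[j /and3P[/eqP E /eqP-> /eqP inv]]]|].
  have [s1 [s2 [_ E1 E2]]] := one_line_split u E.
  exists s1, (u i).+1, (u j).+1, s2; split=> //; rewrite ltnS.
  rewrite ltn_neqAle leqNgt; apply/andP; split.
    by apply/eqP=> /val_inj/perm_inj ij; move: E; rewrite ij => /n_Sn.
  apply/negP=> lt.
  have: inversions (tperm i j * (tperm i j * u)) =
        (inversions (tperm i j * u)).+1.
    by apply: inversions_swap => //; rewrite !permM tpermL tpermR.
  by rewrite mulgA tperm2 mul1g inv; lia.
case=> s1 [a [b [s2 [ab Eu Ev]]]].
have sz : (size s1 + (size s2).+2 = n)%N.
  by have := congr1 size Eu; rewrite size_map size_enum_ord size_cat /= => ->.
have hi : (size s1 < n)%N by rewrite -sz -addSnnS leq_addr.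
have hj : ((size s1).+1 < n)%N by rewrite -sz -!addSnnS leq_addr.
pose i := Ordinal hi; pose j := Ordinal hj.
have E : j = i.+1 :> nat by [].
have [t1 [t2 [st E1 E2]]] := one_line_split u E.
move: Eu; rewrite E1 => /eqP; rewrite eqseq_cat //.
case/andP=> /eqP Et /eqP[Ea Eb Et2].
have Ew : v = (tperm i j * u)%g.
  by apply: one_line_inj; rewrite E2 Ev Et Ea Eb Et2.
apply/existsP; exists i; apply/existsP; exists j.
by rewrite E eqxx Ew eqxx inversions_swap //= -ltnS Ea Eb.
Qed.

End WeakOrder.

Theorem theorem6p1 (d : Order.disp_t) (L : finTBLatticeType d) (n : nat)
    (w : n.+1.-tuple L) (hw : is_Mchain w) :
  exists lab : maxchain L -> 'S_n,
    (forall m : maxchain L,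
       one_line (lab m) = label_seq (Mchain_label w) (val m)) /\
    (forall m1 m2 : maxchain L, mcd_le (Mchain_label w) m1 m2 ->
       exists u v : 'S_n, weak_le u v /\
         rel_iso (mcd_le (Mchain_label w)) (@weak_le n)
           (rel_itv (mcd_le (Mchain_label w)) m1 m2)
           (rel_itv (@weak_le n) u v) lab).
Proof.
have [lab labE] := fin_all_exists (fun m => one_line_exists (labels_perm hw m)).
exists lab; split=> // m1 m2 le12.
have lab_inj m m' b : mcd_le (Mchain_label w) m b -> mcd_le (Mchain_label w) m' b ->
    lab m = lab m' -> m = m'.
  move=> mb mb' E; apply: (mcd_le_labels_inj hw mb mb').
  by rewrite -!labE E.
have lab_homo m m' : mcd_le (Mchain_label w) m m' -> weak_le (lab m) (lab m').
  case/connectP=> p + ->; elim: p m => [|a p IH] m /=; first by rewrite /weak_le connect0.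
  case/andP=> mv /IH; apply: connect_trans; apply: connect1.
  by apply/weak_stepP; rewrite !labE; apply: move_adjacent_swap.
(* Paths of the weak order lift from their upper end. *)
have lab_lift v m' : weak_le v (lab m') ->
    exists2 m, mcd_le (Mchain_label w) m m' & lab m = v.
  case/connectP=> p; elim: p v => [|a p IH] v /=.
    by move=> _ <-; exists m'; rewrite // /mcd_le connect0.
  case/andP=> /weak_stepP st /IH{}IH /IH[b lb Eb].
  rewrite -Eb labE in st; have [m mv Em] := adjacent_swap_lift hw st.
  exists m; first by apply: connect_trans lb; apply: connect1.
  by apply: one_line_inj; rewrite labE.
exists (lab m1), (lab m2); split; first exact: lab_homo.
have mono m m' b : mcd_le (Mchain_label w) m b -> mcd_le (Mchain_label w) m' b ->
    weak_le (lab m) (lab m') = mcd_le (Mchain_label w) m m'.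
  move=> mb mb'; apply/idP/idP => [/lab_lift[c lc Ec]|]; last exact: lab_homo.
  by rewrite -(lab_inj _ _ _ (connect_trans lc mb') mb Ec).
split.
- (* the lift m of v below m2 is above m1, as the order is reflected below m2 *)
  apply/setP=> v; rewrite inE; apply/imsetP/andP => [[m]|[le1 /lab_lift[m lm Em]]].
    by rewrite inE => /andP[/lab_homo ? /lab_homo ?] ->.
  exists m => //; rewrite inE lm andbT.
  by rewrite -(mono _ _ _ le12 lm) Em.
- by move=> m m'; rewrite !inE => /andP[_ mb] /andP[_ mb']; apply: lab_inj mb mb'.
- by move=> m m'; rewrite !inE => /andP[_ mb] /andP[_ mb']; apply: mono mb mb'.
Qed.
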